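(* Let $n\ge 2$ and let $d$ be an integer with $1\le d\le n-1$ such that $\mathscr{T}_{n,d}$ is nonempty. Let $i=\lfloor\frac{d}{2}\rfloor+1$ or $i=\lceil\frac{d}{2}\rceil+1$ (the two choices give isomorphic trees $\hat{T}_{n,i}^d$). Then $\hat{T}_{n,i}^d$ is, up to isomorphism, the unique tree that maximizes the total number of subtrees $F$ among all trees in $\mathscr{T}_{n,d}$; that is, for every $T\in\mathscr{T}_{n,d}$ one has $F(T)\le F(\hat{T}_{n,i}^d)$, with equality if and only if $T\cong\hat{T}_{n,i}^d$. Moreover $$F(\hat{T}_{n,i}^d)=2^{n-d-1}\left(\left\lfloor \frac{d}{2}\right \rfloor+1\right)\left(\left\lceil \frac{d}{2} \right\rceil+1\right)+ \binom{\lfloor \frac{d}{2} \rfloor+1}{2}+\binom{\lceil \frac{d}{2} \rceil+1}{2}+n-d-1.$$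
   Context: All graphs are finite and simple. A subtree of a tree $T$ is a (nonempty) connected induced subgraph of $T$; $F(T)$ denotes the total number of subtrees of $T$ (with at least one vertex; subtrees are counted as distinct subgraphs, not up to isomorphism). The diameter of a tree is the maximum distance (number of edges) between two of its vertices. $\mathscr{T}_{n,d}$ is the set of all $n$-vertex trees of diameter $d$. For $1\le k\le d+1$, $\hat{T}_{n,k}^d$ is the $n$-vertex tree obtained from the path $v_1v_2\ldots v_dv_{d+1}$ by attaching $n-d-1$ pendant edges (each with a new leaf) to the vertex $v_k$. *)

(* Defs.v *)
From mathcomp Require Import all_boot.

Set Implicit Arguments.
Unset Strict Implicit.
Unset Printing Implicit Defensive.

Record sgraph := SGraph {
  vertex :> finType;
  adj : rel vertex;
  adj_sym : symmetric adj;
  adj_irrefl : irreflexive adj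
}.

Definition isomorphic (G H : sgraph) : Prop :=
  exists2 f : G -> H, bijective f & forall x y, adj (f x) (f y) = adj x y.

Section GraphNotions.
Variable G : sgraph.
Implicit Types (S : {set G}) (x y : G).

Definition induced_adj S : rel G :=
  [rel x y | [&& x \in S, y \in S & adj x y]].

Definition connected_set S : bool :=
  (S != set0) && [forall x in S, forall y in S, connect (induced_adj S) x y].

Definition acyclic : Prop :=
  forall c : seq G, 2 < size c -> ~~ (cycle (@adj G) c && uniq c).

Definition is_tree : Prop := connected_set [set: G] /\ acyclic.

(* An induced subgraph is determined by its vertex set, so the subtrees of a
   tree are counted through their vertex sets. *)
Definition num_subtrees : nat := #|[set S : {set G} | connected_set S]|.

Definition walk_of_length x y (k : nat) : bool :=
  [exists p : k.-tuple G, path (@adj G) x p && (last x p == y)].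

(* The least length of a walk from x to y. Shortest walks repeat no vertex, so
   lengths below #|G| suffice; the value is #|G| if x and y are not connected. *)
Definition dist x y : nat := find (walk_of_length x y) (iota 0 #|G|).

Definition diameter : nat := \max_(x : G) \max_(y : G) dist x y.

End GraphNotions.

Definition tree_class (n d : nat) (G : sgraph) : Prop :=
  [/\ is_tree G, #|G| = n & diameter G = d].

Section PathWithPendants.
Variables n d k : nat.

(* The path vertex v_j (1 <= j <= d + 1) is inl of the ordinal j - 1; the new
   leaves are the inr's. Meaningful for d + 1 <= n and 1 <= k <= d + 1. *)
Definition That_vertex : finType := ('I_d.+1 + 'I_(n - d - 1))%type.

Definition That_adj : rel That_vertex := fun u v =>
  match u, v with
  | inl a, inl b => (a.+1 == b :> nat) || (b.+1 == a :> nat)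
  | inl a, inr _ | inr _, inl a => a.+1 == k
  | inr _, inr _ => false
  end.

Lemma That_adj_sym : symmetric That_adj.
Proof. by move=> [a|a] [b|b] //=; rewrite orbC. Qed.

Lemma That_adj_irrefl : irreflexive That_adj.
Proof. by move=> [a|a] //=; rewrite orbb gtn_eqF. Qed.

Definition That : sgraph := SGraph That_adj_sym That_adj_irrefl.

End PathWithPendants.

(* Main.v *)
Require Import Defs.
From mathcomp Require Import all_boot.
From mathcomp Require Import zify.

(** Fix a tree of diameter d with a geodesic p on d + 1 vertices, and grow a connected vertex
    set A from the vertices of p to the whole tree, one vertex at a time
    (grow_connected_set). As the tree is acyclic, the new vertex w has a unique
    neighbor u in A, so that w is a leaf of w |: A. Write N A X for the number
    of subtrees inside A that contain X. Deleting w from a subtree that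
    contains w leaves a subtree that contains u, or nothing if the subtree was
    {w}; hence (subtrees_leaf, subtrees_grow)
      N (w |: A) set0 = N A set0 + 1 + N A {u},
      N (w |: A) {w}  = 1 + N A {u},
      N (w |: A) {x}  = N A {x} + N A {u, x}   for x in A.
    The last line is at most 2 * N A {x}, with equality only if x = u, because
    the subtree {x} of A is not counted by N A {u, x} when x != u.

    Let M = (floor(d/2) + 1) * (ceil(d/2) + 1). On the path itself the same
    recursion gives N {v_j} = (j + 1) * (d + 1 - j) at the vertex of index j,
    which is at most M, with equality exactly at the one or two central
    vertices (subtrees_path, central_product). Growing from there,
    N A {x} <= 2 ^ (#|A| - d - 1) * M for every x, and equality forces x to be
    a central vertex of p to which everything outside p is attached. Summing
    the increments 1 + N A {u} bounds N A set0 by the announced formula, and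
    equality in the last step already forces the structure of the whole tree
    (subtrees_bound). Conversely this structure gives equality at every step
    (subtrees_hub), and it determines the tree up to isomorphism
    (hub_isomorphic).

    The diameter provides the path p (geodesic); that the extremal tree has
    diameter d itself is That_diameter. *)

Set Implicit Arguments.
Unset Strict Implicit.
Unset Printing Implicit Defensive.

Lemma connect_homo (T T' : finType) (e : rel T) (e' : rel T') (f : T -> T') :
  (forall x y, e x y -> connect e' (f x) (f y)) ->
  forall x y, connect e x y -> connect e' (f x) (f y).
Proof.
move=> ef x y /connectP[p + ->]; elim: p x => [|z p IHp] x //=.
by case/andP=> /ef xz /IHp; apply: connect_trans.
Qed.

(** * Connected sets in acyclic graphs *)

Section ConnectedSets.
Variable G : sgraph.
Implicit Types (A S X : {set G}) (u w x y : G).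

Lemma connected_setP S :
  reflect (S != set0 /\ {in S &, forall x y, connect (induced_adj S) x y})
          (connected_set S).
Proof.
apply: (iffP andP) => -[S0 Sc]; split=> //.
  by move=> x y xS yS; apply: (forall_inP (forall_inP Sc x xS)).
by apply/forall_inP=> x xS; apply/forall_inP=> y; apply: Sc.
Qed.

Lemma connected_set1 x : connected_set [set x].
Proof.
apply/connected_setP; split=> [|y z /set1P-> /set1P->]; last exact: connect0.
by apply/set0Pn; exists x; apply: set11.
Qed.

Lemma connected_setU1 S u w :
  connected_set S -> u \in S -> adj u w -> connected_set (w |: S).
Proof.
move=> /connected_setP[_ Sc] uS uw; apply/connected_setP; split.
  by apply/set0Pn; exists w; apply: setU11.
have wu : adj w u by rewrite adj_sym.
have Sc' : {in S &, forall x y, connect (induced_adj (w |: S)) x y}.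
  move=> x y xS yS; apply: (@connect_homo _ _ _ _ id) (Sc x y xS yS) => a b.
  by case/and3P=> aS bS ab; apply: connect1; rewrite /induced_adj /= !inE aS bS ab !orbT.
have uw' : connect (induced_adj (w |: S)) u w.
  by apply: connect1; rewrite /induced_adj /= !inE eqxx uS uw orbT.
have wu' : connect (induced_adj (w |: S)) w u.
  by apply: connect1; rewrite /induced_adj /= !inE eqxx uS wu orbT.
move=> x y /setU1P[->|xS] /setU1P[->|yS] //.
- exact: connect_trans wu' (Sc' _ _ uS yS).
- exact: connect_trans (Sc' _ _ xS uS) uw'.
- exact: Sc'.
Qed.

(** Redirecting w to its only neighbor u turns every walk in S into a walk in
    S :\ w: an edge at w collapses to the single vertex u. *)
Lemma connected_setD1 S u w :
  connected_set S -> u \in S -> u != w ->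
  {in S, forall x, adj w x -> x = u} -> connected_set (S :\ w).
Proof.
move=> /connected_setP[_ Sc] uS uw wu; apply/connected_setP; split.
  by apply/set0Pn; exists u; rewrite !inE uw.
pose r x := if x == w then u else x.
move=> x y /setD1P[xw xS] /setD1P[yw yS].
suff: connect (induced_adj (S :\ w)) (r x) (r y).
  by rewrite /r (negPf xw) (negPf yw).
apply: connect_homo (Sc x y xS yS) => a b /and3P[aS bS ab] {x y xw xS yw yS}.
rewrite /r; case: (eqVneq a w) => [aw|aw]; case: (eqVneq b w) => [bw|bw] //.
- by rewrite (wu b bS) -?aw.
- by rewrite -(wu a aS) // -bw adj_sym.
- by apply: connect1; rewrite /induced_adj /= !inE aw aS bw bS.
Qed.

(** Two neighbors of w in A, joined by a path inside A, would close a cycle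
    through w. *)
Lemma unique_neighbor A w u v :
  acyclic G -> connected_set A -> w \notin A ->
  u \in A -> v \in A -> adj w u -> adj w v -> u = v.
Proof.
move=> acG /connected_setP[_ Ac] wA uA vA wu wv.
have /connectP[p0] := Ac u v uA vA.
case/shortenP=> p pp up _ vp {p0}.
have pA : {subset p <= A}.
  elim: p u {uA wu up vp} pp => // y p IHp u /= /andP[/and3P[_ yA _] /IHp yp].
  by move=> z; rewrite inE => /predU1P[->|/yp].
have padj : path (@adj G) u p by apply: sub_path pp => a b /and3P[].
case: p => [|y p] in pp up vp pA padj *; first by rewrite vp.
have := acG [:: w, u, y & p] isT.
have -> : cycle (@adj G) [:: w, u, y & p].
  rewrite (cycle_path w) /= -[last y p]/(last u (y :: p)) -vp adj_sym wv wu.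
  exact: padj.
rewrite andTb cons_uniq up andbT negbK !inE => /or3P[/eqP wu'|/eqP wy|wp].
- by rewrite wu' uA in wA.
- by rewrite wy pA ?mem_head in wA.
- by rewrite (pA w) ?inE ?wp ?orbT in wA.
Qed.

(** * Counting subtrees when a leaf is added *)

(** The set X is a parameter so that one recursion handles the counts of all
    subtrees, of those through one vertex and of those through two. *)
Definition subtrees A X :=
  [set S : {set G} | [&& connected_set S, S \subset A & X \subset S]].

Lemma num_subtreesE : num_subtrees G = #|subtrees setT set0|.
Proof. by apply: eq_card => S; rewrite !inE subsetT sub0set !andbT. Qed.

Lemma subtrees_set1 w X : X \subset [set w] -> #|subtrees [set w] X| = 1.
Proof.
move=> Xw; rewrite -(cards1 [set w]); apply: eq_card => S; rewrite !inE.
apply/and3P/eqP => [[Sc + _]|->]; last by rewrite connected_set1.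
by rewrite subset1; case/orP=> /eqP S0 //; move: Sc; rewrite S0 /connected_set eqxx.
Qed.

Section AddLeaf.
Variables (A : {set G}) (u w : G).
Hypotheses (acG : acyclic G) (Ac : connected_set A).
Hypotheses (uA : u \in A) (wA : w \notin A) (uw : adj u w).

(** Adding w is a bijection from the subtrees of A through u onto the subtrees
    of w |: A through w other than {w}; the term X == set0 counts {w}. *)
Lemma subtrees_leaf X : X \subset A ->
  #|subtrees (w |: A) (w |: X)| = (X == set0) + #|subtrees A (u |: X)|.
Proof.
move=> XA.
have wX : w \notin X by apply: contra wA; apply: (subsetP XA).
have nbr x : x \in A -> adj w x -> x = u.
  by move=> xA wx; apply: (unique_neighbor acG Ac wA) => //; rewrite adj_sym.
have wneu : u != w by apply: contraNneq wA => <-.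
rewrite (cardsD1 [set w]) inE connected_set1 !sub1set setU11 /=.
rewrite subUset subxx /= subset1.
have -> : (X == [set w]) = false.
  by apply: contraNF wX => /eqP->; apply: set11.
congr (_ + _).
have injf : {in subtrees A (u |: X) &, injective (fun S => w |: S)}.
  move=> S T; rewrite !inE => /and3P[_ SA _] /and3P[_ TA _] eST.
  have wN (B : {set G}) : B \subset A -> w \notin B.
    by move=> BA; apply: contra wA; apply: (subsetP BA).
  by rewrite -(setU1K (wN S SA)) eST setU1K ?wN.
rewrite -(card_in_imset injf); apply: eq_card => S; apply/idP/imsetP => [|[T]].
  rewrite !inE => /and4P[Sw Sc SA]; rewrite subUset sub1set => /andP[wS XS].
  have SD : S :\ w \subset A.
    by apply/subsetP=> x /setD1P[xw /(subsetP SA)/setU1P[xw'|//]]; rewrite xw' eqxx in xw.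
  (* Being connected and different from {w}, S contains a neighbor of w, and
     u is the only candidate. *)
  have uS : u \in S.
    apply: contraNT Sw => uS; rewrite eqEsubset sub1set wS andbT.
    apply/subsetP=> y yS; rewrite inE; apply/eqP/esym.
    case/connected_setP: Sc => _ /(_ w y wS yS)/connectP[[|z p] //=].
    case/andP=> /and3P[_ zS wz] _ _; case/negP: uS; rewrite -(nbr z) //.
    apply: (subsetP SD); rewrite !inE zS andbT.
    by apply: contraTneq wz => ->; rewrite adj_irrefl.
  exists (S :\ w); last by rewrite setD1K.
  rewrite inE SD subUset sub1set !inE wneu uS subsetD1 XS wX andbT /=.
  rewrite andbT; apply: (connected_setD1 Sc uS wneu) => x xS wx; apply: nbr => //.
  apply: (subsetP SD); rewrite !inE xS andbT.
  by apply: contraTneq wx => ->; rewrite adj_irrefl.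
rewrite inE subUset sub1set => /and4P[Tc TA uT XT] ->; rewrite !inE.
rewrite (connected_setU1 Tc uT uw) !setUS // !andbT.
apply: contraNneq wA => E; suff: u == w by move/eqP<-.
by rewrite -in_set1 -E inE uT orbT.
Qed.

Lemma subtrees_grow X : X \subset A ->
  #|subtrees (w |: A) X| =
  #|subtrees A X| + ((X == set0) + #|subtrees A (u |: X)|).
Proof.
move=> XA; rewrite -subtrees_leaf // addnC.
rewrite -(cardsID [set S : {set G} | w \in S]); congr (_ + _); apply: eq_card => S.
  by rewrite !inE subUset sub1set; case: (w \in S); rewrite ?andbF ?andbT //=.
rewrite !inE; case: (boolP (w \in S)) => wS /=.
  case: (boolP (S \subset A)) => [SA|]; last by rewrite andbF.
  by case/negP: wA; apply: (subsetP SA).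
congr [&& _, _ & _]; apply/idP/idP => [/subsetP SA|/subset_trans->//].
  by apply/subsetP=> x xS; case/setU1P: (SA x xS) => // xw; rewrite -xw xS in wS.
exact: subsetUr.
Qed.

End AddLeaf.

(** In a connected graph some edge leaves every connected proper subset; P is
    enlarged along such edges. This induction replaces the removal of leaves,
    and it keeps all sets inside one fixed graph. *)
Lemma grow_connected_set (P : {set G}) (Q : {set G} -> Prop) :
  connected_set [set: G] -> connected_set P -> Q P ->
  (forall A u w, connected_set A -> P \subset A -> u \in A -> w \notin A ->
     adj u w -> Q A -> Q (w |: A)) ->
  Q setT.
Proof.
move=> /connected_setP[_ Gc] Pc QP step.
suff: forall k A, #|~: A| = k -> connected_set A -> P \subset A -> Q A -> Q setT.
  by move/(_ _ P erefl Pc (subxx _) QP).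
elim=> [|k IHk] A cA Ac PA QA.
  by rewrite -[setT]setCK setCT -(cards0_eq cA) setCK.
have [u uA [w wA uw]] : exists2 u, u \in A & exists2 w, w \notin A & adj u w.
  have /set0Pn[x xA] : A != set0 by case/connected_setP: Ac.
  have /card_gt0P[y] : 0 < #|~: A| by rewrite cA.
  rewrite inE => yA; have := Gc x y (in_setT x) (in_setT y).
  case/connectP=> p + E; rewrite {y}E in yA *.
  elim: p x xA yA => [|z p IHp] x xA /=; first by rewrite xA.
  move=> yA /andP[/and3P[_ _ xz] zp]; case: (boolP (z \in A)) => zA.
    exact: IHp zA yA zp.
  by exists x => //; exists z.
apply: (IHk (w |: A)).
- by have := cardsC A; have := cardsC (w |: A); rewrite cardsU1 wA; lia.
- exact: connected_setU1 Ac uA uw.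
- exact: subset_trans PA (subsetUr _ _).
- exact: step uw QA.
Qed.

End ConnectedSets.

(** * The extremal values *)

Definition central d j := (j == d./2) || (j == uphalf d).

Definition max_through d := d./2.+1 * (uphalf d).+1.

(** The two factors have the constant sum d + 2, so their product is largest
    when they are as equal as possible. *)
Lemma central_product d j : j <= d ->
  j.+1 * (d.+1 - j) <= max_through d ?= iff central d j.
Proof.
rewrite /max_through /central uphalf_half.
rewrite -{1 2}(odd_double_half d); move: (odd d) (d./2) => b h jd.
split.
  case: b jd => jd; case: (leqP j h) => jh.
  - by have [k ->] : exists k, h = j + k; [exists (h - j); lia | nia].
  - by have [k ->] : exists k, j = h + k; [exists (j - h); lia | nia].
  - by have [k ->] : exists k, h = j + k; [exists (h - j); lia | nia].
  - by have [k ->] : exists k, j = h + k; [exists (j - h); lia | nia].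
apply/eqP/orP => [|[/eqP->|/eqP->]]; last first.
- by case: b {jd}; nia.
- by case: b {jd}; nia.
case: b jd => jd; case: (leqP j h) => jh E; [left|right|left|left]; apply/eqP.
- have [k hk] : exists k, h = j + k by exists (h - j); lia.
  (* M - (j + 1) * (d + 1 - j), with d = 2 * h + 1 *)
  have : k * k.+1 = 0 by subst h; nia.
  by case: k hk => //; lia.
- have [k hk] : exists k, j = h.+1 + k by exists (j - h.+1); lia.
  have : k * k.+1 = 0 by subst j; nia.
  by case: k hk => //; lia.
- have [k hk] : exists k, h = j + k by exists (h - j); lia.
  have : k * k = 0 by subst h; nia.
  by case: k hk => //; lia.
- have [k hk] : exists k, j = h + k by exists (j - h); lia.
  have : k * k = 0 by subst j; nia.
  by case: k hk => //; lia.
Qed.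

Definition max_subtrees n d :=
  2 ^ (n - d - 1) * max_through d
  + 'C(d./2.+1, 2) + 'C((uphalf d).+1, 2) + (n - d - 1).

(** The C(d + 2, 2) subpaths, split at a central vertex: through it, on one
    side of it, on the other. *)
Lemma max_subtrees_path d : max_subtrees d.+1 d = 'C(d.+2, 2).
Proof.
rewrite /max_subtrees /max_through subSnn subnn addn0 mul1n.
have dE : d.+2 = d./2.+1 + (uphalf d).+1.
  by rewrite uphalf_half addnS addSn addnCA addnn odd_double_half.
have binD a b : 'C(a + b, 2) = a * b + 'C(a, 2) + 'C(b, 2).
  elim: a => [|a IHa]; first by rewrite bin0n.
  by rewrite addSn !binS !bin1 IHa; lia.
by rewrite dE binD.
Qed.

Lemma max_subtreesS n d : d < n ->
  max_subtrees n.+1 d = max_subtrees n d + (1 + 2 ^ (n - d - 1) * max_through d).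
Proof.
move=> dn; rewrite /max_subtrees.
have -> : n.+1 - d - 1 = (n - d - 1).+1 by lia.
by rewrite expnS; lia.
Qed.

(** * Subtrees of a path *)

Section PathCounts.
Variable G : sgraph.
Hypothesis acG : acyclic G.

(** Induction along the path, whose next vertex is a leaf attached to the last
    one. The counts through x and the last vertex make the induction close:
    they do not change when the path is extended, and they are the increments
    of the counts through x. *)
Lemma subtrees_path (p : seq G) :
  p != [::] -> uniq p -> sorted (@adj G) p ->
  let P := [set x in p] in
  [/\ connected_set P, #|subtrees P set0| = 'C((size p).+1, 2),
      {in p, forall x, #|subtrees P [set x]| = (index x p).+1 * (size p - index x p)}
    & {in p, forall x, #|subtrees P [set x; last x p]| = (index x p).+1}].
Proof.
elim/last_ind: p => // -[|x0 q] w IHp _.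
  move=> _ _ /=; have -> : [set x in [:: w]] = [set w] by apply/setP=> z; rewrite !inE.
  split; first exact: connected_set1.
  - by rewrite subtrees_set1 ?sub0set.
  - by move=> x; rewrite inE => /eqP->; rewrite subtrees_set1 //= eqxx.
  - by move=> x; rewrite inE => /eqP->; rewrite /= setUid subtrees_set1 //= eqxx.
set p := x0 :: q in IHp *; rewrite rcons_uniq => /andP[wp up] sp P.
have {sp} [sp uw] : sorted (@adj G) p /\ adj (last x0 q) w.
  by move: sp; rewrite /= rcons_path => /andP[].
have lastE x : last x p = last x0 q by [].
set u := last x0 q in uw lastE.
have pu : u \in p by apply: mem_last.
have [Ac IH0 IH1 IH2] := IHp isT up sp.
have indu : index u p = size q by rewrite /u index_last.
set A := [set x in p] in Ac IH0 IH1 IH2.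
have uA : u \in A by rewrite inE.
have wA : w \notin A by rewrite inE.
have -> : P = w |: A by apply/setP=> z; rewrite in_setU1 !in_set mem_rcons in_cons.
have indp x : x \in p -> index x (rcons p w) = index x p.
  by move=> xp; rewrite -cats1 index_cat xp.
have indw : index w (rcons p w) = size p.
  by rewrite -cats1 index_cat (negPf wp) /= eqxx addn0.
have leaf := subtrees_leaf acG Ac uA wA uw.
have grow := subtrees_grow acG Ac uA wA uw.
have Nu : #|subtrees A [set u]| = size p by rewrite IH1 // indu /= subSnn muln1.
have Nw : #|subtrees (w |: A) [set w]| = (size p).+1.
  by have := leaf set0 (sub0set _); rewrite !setU0 eqxx Nu.
have N2 x : x \in p -> #|subtrees A (u |: [set x])| = (index x p).+1.
  by move=> xp; rewrite setUC -IH2 // lastE.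
have nz x : ([set x : G] == set0) = false by rewrite -cards_eq0 cards1.
rewrite size_rcons; split.
- exact: connected_setU1 Ac uA uw.
- by rewrite grow ?sub0set // IH0 eqxx setU0 Nu [RHS]binS bin1 add1n.
- move=> x; rewrite mem_rcons inE => /predU1P[->|xp].
    by rewrite indw Nw subSnn muln1.
  have xA : [set x] \subset A by rewrite sub1set inE.
  rewrite grow // IH1 // nz N2 // indp //.
  by rewrite -index_mem in xp; rewrite subSn 1?ltnW // mulnS add0n addnC.
- move=> x; rewrite last_rcons mem_rcons inE => /predU1P[->|xp].
    by rewrite setUid indw Nw.
  have xA : [set x] \subset A by rewrite sub1set inE.
  by rewrite (setUC [set x]) leaf // nz N2 // indp.
Qed.

(** * Growing a tree around a path *)

Definition hub (p : seq G) (A : {set G}) x :=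
  x \in p /\ {in A, forall w, w \notin p -> adj x w}.

Section AroundPath.
Hypothesis Gc : connected_set [set: G].
Variables (d : nat) (p : seq G).
Hypothesis size_p : size p = d.+1.
Hypotheses (up : uniq p) (sp : sorted (@adj G) p).
Let P := [set x in p].

Let p_neq0 : p != [::]. Proof. by rewrite -size_eq0 size_p. Qed.

Let cardP : #|P| = d.+1.
Proof. by rewrite cardsE (card_uniqP up). Qed.

Lemma subtrees_path_base :
  [/\ connected_set P, #|subtrees P set0| = max_subtrees d.+1 d &
      {in p, forall x, #|subtrees P [set x]| <= max_through d
                       ?= iff central d (index x p)}].
Proof.
have [Pc P0 P1 _] := subtrees_path p_neq0 up sp.
split; rewrite ?P0 ?size_p ?max_subtrees_path // => x xp.
rewrite P1 // size_p; apply: central_product.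
by rewrite -ltnS -size_p index_mem.
Qed.


(** The bounds and the equality cases are carried along together, since the
    bound on all subtrees is a sum of bounds on subtrees through one vertex.
    Positivity of d makes M at least 2, which is why a subtree count through a
    newly added leaf never attains its bound. *)
Lemma subtrees_bound : 0 < d ->
  #|subtrees [set: G] set0| <= max_subtrees #|G| d /\
  (#|subtrees [set: G] set0| = max_subtrees #|G| d ->
   exists2 x, hub p setT x & central d (index x p)).
Proof.
move=> d_gt0; have [Pc P0 P1] := subtrees_path_base.
have Mgt1 : 1 < max_through d.
  by rewrite /max_through uphalf_half; have := odd_double_half d; case: (odd d); nia.
pose Q (A : {set G}) :=
  {in A, forall x,
     #|subtrees A [set x]| <= 2 ^ (#|A| - d.+1) * max_through d /\
     (#|subtrees A [set x]| = 2 ^ (#|A| - d.+1) * max_through d ->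
      hub p A x /\ central d (index x p))} /\
  #|subtrees A set0| <= max_subtrees #|A| d /\
  (#|subtrees A set0| = max_subtrees #|A| d ->
   exists2 x, hub p A x & central d (index x p)).
suff [_] : Q setT by rewrite cardsT.
apply: (grow_connected_set Gc Pc); rewrite {}/Q.
  rewrite cardP subnn mul1n; split=> [x|].
    rewrite inE => xp; have [le_x eq_x] := P1 x xp; split=> // e.
    by rewrite -eq_x e; split=> //; split=> // w; rewrite inE => ->.
  split=> [|_]; first by rewrite P0.
  have [x0 x0p] : exists x0, x0 \in p.
    by case: (p) p_neq0 => // x0 q _; exists x0; apply: mem_head.
  have mid : d./2 < size p by rewrite size_p; lia.
  exists (nth x0 p d./2); last by rewrite index_uniq // /central eqxx.
  by split=> [|w]; [apply: mem_nth | rewrite inE => ->].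
move=> A u w Ac PA uA wA uw [H1 [H2 H3]].
have dA : d < #|A| by rewrite -cardP subset_leq_card.
have cardA : #|w |: A| = #|A|.+1 by rewrite cardsU1 wA.
have wP : w \notin P by apply: contra wA; apply: (subsetP PA).
have grow := subtrees_grow acG Ac uA wA uw.
have leaf := subtrees_leaf acG Ac uA wA uw.
have nz x : ([set x : G] == set0) = false by rewrite -cards_eq0 cards1.
have [B BE] : exists B, B = 2 ^ (#|A| - d.+1) * max_through d by eexists.
have B2 : 2 ^ (#|A|.+1 - d.+1) * max_through d = B + B.
  by rewrite subSn // expnS -mulnA -BE mul2n addnn.
have Bgt1 : 1 < B by rewrite BE (leq_trans Mgt1) // leq_pmull // expn_gt0.
rewrite -BE in H1.
have [leU eqU] := H1 u uA.
have hubS x : hub p A x -> adj x w -> hub p (w |: A) x.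
  by case=> xp xA xw; split=> // z /setU1P[->|/xA].
split=> [x|]; rewrite cardA.
  rewrite B2; case/setU1P=> [->|xA].
    have := leaf set0 (sub0set _); rewrite !setU0 eqxx => ->.
    have lt : 1 + #|subtrees A [set u]| < B + B.
      by rewrite add1n -addn2 leq_add.
    by split=> [|E]; [exact: ltnW | rewrite E ltnn in lt].
  have [leX eqX] := H1 x xA.
  rewrite grow ?sub1set // nz add0n.
  have [->|xu] := eqVneq x u.
    rewrite setUid; split=> [|E]; first exact: leq_add.
    have [|hubu cu] := eqU; first by apply: double_inj; rewrite -!addnn.
    by split=> //; apply: hubS.
  (* Strict because {x} does not contain u. *)
  have ltX : #|subtrees A (u |: [set x])| < #|subtrees A [set x]|.
    apply: proper_card; apply/properP; split.
      apply/subsetP=> S; rewrite !inE => /and3P[-> ->]; rewrite subUset.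
      by case/andP.
    exists [set x]; first by rewrite inE connected_set1 sub1set xA subxx.
    by rewrite inE subUset !sub1set !inE eq_sym (negPf xu) !andbF.
  have lt : #|subtrees A [set x]| + #|subtrees A (u |: [set x])| < B + B.
    by rewrite -addnS leq_add // (leq_trans ltX).
  by split=> [|E]; [exact: ltnW | rewrite E ltnn in lt].
rewrite grow ?sub0set // eqxx setU0 max_subtreesS // subn1 -subnS -BE.
split=> [|E]; first by rewrite leq_add // leq_add2l.
have [|hubu cu] := eqU; last by exists u => //; apply: hubS.
apply/eqP; rewrite eqn_leq leU.
by rewrite -(leq_add2l 1) -(leq_add2l (max_subtrees #|A| d)) -E leq_add2r.
Qed.

(** When all vertices outside p hang on x, the vertex u at which the set grows
    is always x, so that the count through x doubles at each step. *)
Lemma subtrees_hub x : hub p setT x -> central d (index x p) ->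
  #|subtrees [set: G] set0| = max_subtrees #|G| d.
Proof.
case=> xp xT cx; have [Pc P0 P1] := subtrees_path_base.
pose Q (A : {set G}) :=
  #|subtrees A [set x]| = 2 ^ (#|A| - d.+1) * max_through d /\
  #|subtrees A set0| = max_subtrees #|A| d.
suff [_] : Q setT by rewrite cardsT.
apply: (grow_connected_set Gc Pc); rewrite {}/Q.
  rewrite cardP subnn mul1n P0; split=> //.
  by apply/eqP; rewrite (P1 x xp).
move=> A u w Ac PA uA wA uw [H1 H2].
have dA : d < #|A| by rewrite -cardP subset_leq_card.
have xA : x \in A by apply: (subsetP PA); rewrite inE.
have wp : w \notin p by apply: contra wA => wp; apply: (subsetP PA); rewrite inE.
have ux : u = x.
  apply: (unique_neighbor acG Ac wA) => //; rewrite adj_sym //.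
  exact: xT (in_setT w) wp.
have grow := subtrees_grow acG Ac uA wA uw; rewrite ux in grow.
have nz : ([set x : G] == set0) = false by rewrite -cards_eq0 cards1.
rewrite !grow ?sub0set ?sub1set // cardsU1 wA add1n nz eqxx setU0 setUid H1 H2.
by rewrite subSn // expnS -mulnA mul2n addnn max_subtreesS // subn1 -subnS.
Qed.

(** A path in an acyclic graph has no chords: v_b has only one neighbor among
    v_0, ..., v_(b-1), which form a connected set. *)
Lemma adj_path x a b : a < b < size p -> adj (nth x p a) (nth x p b) = (a.+1 == b).
Proof.
case/andP=> ab bp; have stepp k : k.+1 < size p -> adj (nth x p k) (nth x p k.+1).
  by move/(sortedP x): sp; apply.
apply/idP/eqP => [e|<-]; last by apply: stepp; apply: leq_ltn_trans bp.
case: b => // b in ab bp e *; have bp' := ltnW bp.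
have sz : size (take b.+1 p) = b.+1 by rewrite size_take bp.
have [|||Ac _ _ _] := subtrees_path (p := take b.+1 p).
- by rewrite -size_eq0 sz.
- exact: take_uniq.
- exact: take_sorted.
have inA k : k <= b -> nth x p k \in [set y in take b.+1 p].
  by move=> kb; rewrite inE -(nth_take x (n0 := b.+1)) // mem_nth // sz.
have bA : nth x p b.+1 \notin [set y in take b.+1 p].
  rewrite inE; apply/(nthP x) => -[k]; rewrite sz => kb; rewrite nth_take //.
  by move/eqP; rewrite nth_uniq ?(ltn_trans kb) //; case: ltngtP kb.
have /eqP : nth x p a = nth x p b.
  apply: (unique_neighbor acG Ac bA) (inA a ab) (inA b (leqnn b)) _ _.
    by rewrite adj_sym.
  by rewrite adj_sym stepp.
by rewrite nth_uniq ?(ltn_trans ab) // => /eqP->.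
Qed.

(** No edges exist besides those of p and those at x: chords of p are excluded
    by adj_path, and any other edge would give a vertex outside p two neighbors
    in the connected set formed by p and at most one further vertex. *)
Lemma hub_isomorphic x : hub p setT x ->
  isomorphic (That #|G| d (index x p).+1) G.
Proof.
case=> xp xT; have [Pc _ _] := subtrees_path_base.
set n := #|G|; have cardC : size (enum (~: P)) = n - d - 1.
  by rewrite -cardE cardsCs setCK cardP subn1 subnS.
have inC (b : 'I_(n - d - 1)) : nth x (enum (~: P)) b \notin p.
  have : nth x (enum (~: P)) b \in enum (~: P) by rewrite mem_nth // cardC.
  by rewrite mem_enum !inE.
pose f (v : That n d (index x p).+1) : G :=
  match v with inl a => nth x p a | inr b => nth x (enum (~: P)) b end.
have ap (a : 'I_d.+1) : a < size p by rewrite size_p.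
exists f.
  apply: inj_card_bij => [[a|b] [a'|b'] /= /eqP|].
  - by rewrite nth_uniq // => /eqP/val_inj->.
  - by move/eqP=> E; case/negP: (inC b'); rewrite -E mem_nth.
  - by move/eqP=> E; case/negP: (inC b); rewrite E mem_nth.
  - by rewrite nth_uniq ?cardC ?enum_uniq // => /eqP/val_inj->.
  rewrite card_sum !card_ord -/n subn1 -subnS subnKC //.
  by rewrite -cardP max_card.
have adjC w : w \notin p -> adj w x by rewrite adj_sym; apply: xT.
have ab_adj (a : 'I_d.+1) (b : 'I_(n - d - 1)) :
    adj (nth x p a) (nth x (enum (~: P)) b) = (a.+1 == (index x p).+1).
  rewrite eqSS; apply/idP/eqP => [e|->]; last by rewrite nth_index // xT.
  have <- : nth x p a = x; last by rewrite index_uniq.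
  apply: (unique_neighbor acG Pc (w := nth x (enum (~: P)) b)).
  - by rewrite inE.
  - by rewrite inE mem_nth.
  - by rewrite inE.
  - by rewrite adj_sym.
  - exact: adjC.
move=> [a|b] [a'|b'] /=.
- case: (ltngtP a a') => [lt|lt|->].
  + rewrite adj_path ?lt //= [a'.+1 == _]gtn_eqF ?orbF //; exact: ltnW.
  + rewrite adj_sym adj_path ?lt //= [a.+1 == _]gtn_eqF //; exact: ltnW.
  + by rewrite adj_irrefl orbb gtn_eqF.
- exact: ab_adj.
- by rewrite adj_sym ab_adj.
- apply/negP => e; set w := nth _ _ b in e; set w' := nth _ _ b' in e.
  have wp : w \notin p by apply: inC.
  have wp' : w' \notin p by apply: inC.
  have xw' : x = w'; last by rewrite -xw' xp in wp'.
  apply: (unique_neighbor acG (w := w) (connected_setU1 Pc _ (xT w' _ wp'))) => //.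
  + by rewrite inE.
  + rewrite !inE negb_or wp andbT.
    by apply: contraTneq e => ->; rewrite adj_irrefl.
  + by rewrite !inE xp orbT.
  + exact: setU11.
  + exact: adjC.
Qed.

End AroundPath.
End PathCounts.

(** * Isomorphisms *)

Lemma isomorphic_sym G H : isomorphic G H -> isomorphic H G.
Proof.
case=> f [g fK gK] fadj; exists g; first by exists f.
by move=> x y; rewrite -fadj !gK.
Qed.

Lemma isomorphic_trans G H K : isomorphic G H -> isomorphic H K -> isomorphic G K.
Proof.
case=> f fB fadj [g gB gadj]; exists (g \o f); first exact: bij_comp.
by move=> x y; rewrite /= gadj fadj.
Qed.

Lemma isomorphic_refl G : isomorphic G G.
Proof. by exists id => //; exists id. Qed.

Lemma num_subtrees_isomorphic G H : isomorphic G H -> num_subtrees G = num_subtrees H.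
Proof.
have le (G1 G2 : sgraph) : isomorphic G1 G2 -> num_subtrees G1 <= num_subtrees G2.
  case=> f /bij_inj fI fadj; rewrite /num_subtrees -(card_imset _ (imset_inj fI)).
  apply/subset_leq_card/subsetP => _ /imsetP[S + ->]; rewrite !inE.
  case/connected_setP=> S0 Sc; apply/connected_setP; split; first by rewrite imset_eq0.
  move=> _ _ /imsetP[x xS ->] /imsetP[y yS ->].
  apply: connect_homo (Sc x y xS yS) => a b /and3P[aS bS ab].
  by apply: connect1; rewrite /induced_adj /= !imset_f // fadj.
by move=> GH; apply/eqP; rewrite eqn_leq !le //; apply: isomorphic_sym.
Qed.

(** * Distances, geodesics and acyclicity *)

Section Distance.
Variable G : sgraph.
Implicit Types (x y z : G) (p : seq G).

Lemma walkP x y k :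
  reflect (exists p, [/\ size p = k, path (@adj G) x p & last x p = y])
          (walk_of_length x y k).
Proof.
apply: (iffP existsP) => [[p /andP[xp /eqP lp]]|[p [<- xp lp]]].
  by exists p; rewrite size_tuple.
by exists (in_tuple p); rewrite xp lp /=.
Qed.

Lemma dist_le x y k : walk_of_length x y k -> dist x y <= k.
Proof.
move=> xy; have [kG|Gk] := ltnP k #|G|; last first.
  by apply: leq_trans (find_size _ _) _; rewrite size_iota.
rewrite leqNgt; apply/negP => /(before_find 0).
by rewrite nth_iota // add0n xy.
Qed.

Lemma dist_walk x y : dist x y < #|G| -> walk_of_length x y (dist x y).
Proof.
move=> xyG; have : has (walk_of_length x y) (iota 0 #|G|).
  by rewrite has_find size_iota.
by move/(nth_find 0); rewrite nth_iota ?add0n.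
Qed.

Lemma dist_ge x y k :
  k <= #|G| -> (forall m, walk_of_length x y m -> k <= m) -> k <= dist x y.
Proof.
move=> kG km; have [/dist_walk/km//|] := ltnP (dist x y) #|G|.
exact: leq_trans.
Qed.

(** Descending along phi gives a walk to y that takes at most phi x steps, so
    that upper bounds on distances need no explicit walks. *)
Lemma dist_le_descent (phi : G -> nat) y :
  (forall x, x != y -> exists2 z, adj x z & phi z < phi x) ->
  forall x, dist x y <= phi x.
Proof.
move=> down x.
suff: forall m x, phi x <= m -> exists2 k, k <= m & walk_of_length x y k.
  by case/(_ _ x (leqnn _)) => k km /dist_le; move/leq_trans; apply.
elim=> [|m IHm] {}x xm; have [->|xy] := eqVneq x y.
- by exists 0 => //; apply/walkP; exists [::].
- by have [z _] := down x xy; rewrite ltnNge (leq_trans xm).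
- by exists 0 => //; apply/walkP; exists [::].
have [z xz zx] := down x xy.
have [|k km /walkP[p [sz zp lp]]] := IHm z; first exact: leq_trans zx xm.
by exists k.+1 => //; apply/walkP; exists (z :: p); rewrite /= sz xz.
Qed.

Lemma walk_lipschitz (psi : G -> nat) x y k :
  (forall u v, adj u v -> psi v <= (psi u).+1) ->
  walk_of_length x y k -> psi y <= psi x + k.
Proof.
move=> lip /walkP[p [<- + <-]] {y k}; elim: p x => [|z p IHp] x /=.
  by rewrite addn0.
case/andP=> /lip xz /IHp zp; apply: leq_trans zp _.
by rewrite addnS -addSn leq_add2r.
Qed.

Lemma dist_le_diameter x y : dist x y <= diameter G.
Proof. by apply: leq_trans (leq_bigmax x); apply: (leq_bigmax (F := dist x)). Qed.

(** A walk of length dist x y repeats no vertex, for removing a loop would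
    shorten it. *)
Lemma geodesic : 0 < #|G| -> diameter G < #|G| ->
  exists p, [/\ size p = (diameter G).+1, uniq p & sorted (@adj G) p].
Proof.
move=> G0 dG; have [x dx] := eq_bigmax (fun x => \max_(y : G) dist x y) G0.
have [y dy] := eq_bigmax (dist x) G0.
have dxy : diameter G = dist x y by rewrite /diameter dx dy.
rewrite dxy in dG *; have /walkP[p0 [sz xp0 lp0]] := dist_walk dG.
case: (shortenP xp0) lp0 => p xp up sub lp.
exists (x :: p); split=> //=; congr _.+1; apply/eqP; rewrite eqn_leq.
apply/andP; split; last by apply: dist_le; apply/walkP; exists p.
by rewrite -sz uniq_leq_size //; case/andP: up.
Qed.

(** A vertex of largest rank on a cycle would have two distinct neighbors of at
    most its rank, namely its neighbors on the cycle. *)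
Lemma acyclic_rank (h : G -> nat) :
  (forall x y z, adj x y -> adj x z -> h y <= h x -> h z <= h x -> y = z) ->
  acyclic G.
Proof.
move=> hP c c2; apply/negP => /andP[cc uc].
have [x0 x0c] : exists x, x \in c by case: c c2 {cc uc} => // x c; exists x; apply: mem_head.
case: (arg_maxnP h x0c) => x xc xmax; case/rot_to: (xc) => i c' rc.
move: cc uc c2; rewrite -(rot_cycle i) -(rot_uniq i) -(size_rot i) rc.
have inc z : z \in c' -> h z <= h x.
  move=> zc; have /xmax // : z \in c.
  by rewrite -(mem_rot i) rc inE zc orbT.
case: c' {rc} inc => // y c'; case/lastP: c' => // c' z inc.
rewrite /= rcons_path last_rcons => /and3P[xy _ zx] /and3P[_ yc _] _.
case/negP: yc; rewrite mem_rcons inE (hP x y z) ?eqxx //.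
- by rewrite adj_sym.
- by apply: inc; rewrite mem_head.
- by apply: inc; rewrite inE mem_rcons mem_head orbT.
Qed.

End Distance.

(** * The path with pendant leaves *)

Section ThatTree.
Variables n d k : nat.
Hypotheses (dn : d < n) (k_gt0 : 0 < k) (kd : k <= d.+1).
Let H := That n d k.

Lemma That_card : #|H| = n.
Proof. by rewrite card_sum !card_ord -subnDA addn1 subnKC. Qed.

Let foot : 'I_d.+1 := inord k.-1.

Let footE : foot = k.-1 :> nat.
Proof. by rewrite /foot inordK // prednK. Qed.

Lemma That_acyclic : acyclic H.
Proof.
apply: (@acyclic_rank H (fun v => match v with inl a => a : nat | inr _ => d.+1 end)).
move=> [a|b] [a1|b1] [a2|b2] //=; try by rewrite [d < a]ltnNge leq_ord.
  move=> /orP[]/eqP e1 /orP[]/eqP e2 l1 l2; congr inl; apply: val_inj => /=; lia.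
by move=> /eqP e1 /eqP e2 _ _; congr inl; apply: val_inj => /=; lia.
Qed.

Lemma That_connected : connected_set [set: H].
Proof.
have step u v : @adj H u v -> connect (induced_adj [set: H]) u v.
  by move=> uv; apply: connect1; rewrite /induced_adj /= !inE.
have sym : connect_sym (induced_adj [set: H]).
  by apply: sym_connect_sym => u v; rewrite /induced_adj /= !inE That_adj_sym.
have spine m : forall a : 'I_d.+1, a = m :> nat ->
    connect (induced_adj [set: H]) (inl ord0) (inl a).
  elim: m => [|m IHm] a am.
    by have -> : a = ord0 by apply: val_inj.
  have md : m < d.+1 by rewrite -am ltnW.
  apply: connect_trans (IHm (Ordinal md) erefl) (step _ _ _).
  by rewrite /= am eqxx.
have all v : connect (induced_adj [set: H]) (inl ord0) v.
  case: v => [a|b]; first exact: spine.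
  apply: connect_trans (spine _ foot erefl) (step _ _ _).
  by rewrite /= footE prednK.
apply/connected_setP; split=> [|u v _ _]; first by apply/set0Pn; exists (inl ord0).
by apply: connect_trans (all v); rewrite sym.
Qed.

Definition spine : seq H := [seq inl a | a <- enum 'I_d.+1].

Lemma That_hub :
  [/\ size spine = d.+1, uniq spine, sorted (@adj H) spine,
      index (inl foot : H) spine = k.-1 & hub spine setT (inl foot : H)].
Proof.
have inj : injective (inl : 'I_d.+1 -> H) by move=> a b [].
have sz : size spine = d.+1 by rewrite size_map size_enum_ord.
split=> //.
- by rewrite map_inj_uniq // enum_uniq.
- have nthS j : j < d.+1 ->
      exists2 a : 'I_d.+1, a = j :> nat & nth (inl ord0 : H) spine j = inl a.
    move=> jd; exists (nth ord0 (enum 'I_d.+1) j); first exact: nth_enum_ord.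
    by rewrite (nth_map ord0) // size_enum_ord.
  apply/(sortedP (inl ord0)) => i; rewrite sz => id.
  have [[a ai ->] [b bi ->]] := (nthS i (ltnW id), nthS i.+1 id).
  by rewrite /= ai bi eqxx.
- by rewrite /spine index_map // index_enum_ord.
split; first by rewrite map_f // mem_enum.
move=> [a|b] _ /=; last by rewrite footE prednK // eqxx.
by rewrite map_f // mem_enum.
Qed.

(** Hanging a leaf on an end vertex would lengthen the path, hence the
    condition on k when there are leaves. *)
Lemma That_diameter : (n = d.+1) \/ 1 < k <= d -> diameter H = d.
Proof.
move=> leaf; apply/eqP; rewrite eqn_leq; apply/andP; split.
  apply/bigmax_leqP => x _; apply/bigmax_leqP => y _.
  (* gap is the distance along the path, written with truncated subtractions. *)
  pose gap (a b : nat) := (a - b) + (b - a).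
  have toward (a b : 'I_d.+1) : a != b ->
      exists2 c : 'I_d.+1, @adj H (inl a) (inl c) & gap c b < gap a b.
    rewrite -val_eqE /= => ab; rewrite /gap; case: (ltngtP a b) ab => // lt _.
      have cd : a.+1 < d.+1 by apply: leq_ltn_trans lt (ltn_ord b).
      by exists (Ordinal cd); rewrite /= ?eqxx //; lia.
    have cd : a.-1 < d.+1 by apply: leq_ltn_trans (leq_pred _) (ltn_ord a).
    by exists (Ordinal cd); rewrite /=; [apply/orP; right; apply/eqP|]; lia.
  case: y => [b|b].
    pose phi (v : H) := match v with inl a => gap a b | inr _ => (gap foot b).+1 end.
    have down (v : H) : v != inl b -> exists2 z, adj v z & phi z < phi v.
      case: v => [a ab|c _].
        by have [|c ac lt] := toward a b; [by apply: contraNneq ab => -> | exists (inl c)].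
      by exists (inl foot) => //=; rewrite footE prednK.
    apply: leq_trans (dist_le_descent down x) _; rewrite /phi /gap footE.
    case: x => [a|c]; first by have := ltn_ord a; have := ltn_ord b; lia.
    have := ltn_ord b; have := ltn_ord c; lia.
  pose phi (v : H) := match v with inl a => (gap a foot).+1 | inr c => (c != b).*2 end.
  have down (v : H) : v != inr b -> exists2 z, adj v z & phi z < phi v.
    case: v => [a _|c cb].
      have [->|/toward[c ac lt]] := eqVneq a foot; last by exists (inl c).
      by exists (inr b); rewrite /= ?footE ?prednK ?eqxx.
    exists (inl foot); first by rewrite /= footE prednK.
    have -> : phi (inr c) = 2 by rewrite /phi (_ : c != b) //; apply: contraNneq cb => ->.
    by rewrite /= /gap subnn.
  apply: leq_trans (dist_le_descent down x) _; rewrite /phi /gap footE.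
  have lb := ltn_ord b; case: x => [a|c]; first by have := ltn_ord a; lia.
  by case: (c != b); lia.
apply: leq_trans (@dist_le_diameter H (inl ord0) (inl ord_max)).
apply: dist_ge => [|m]; first by rewrite That_card ltnW.
(* The projection of the tree onto its path, with each leaf sent to its foot,
   changes by at most one along an edge. *)
pose psi (v : H) := match v with inl a => a : nat | inr _ => k.-1 end.
move/(@walk_lipschitz H psi); apply => -[a|b] [a'|b'] //=; lia.
Qed.

End ThatTree.

(** Reading the path backwards moves the foot from index j to index d - j. *)
Lemma That_mirror n d j : d < n -> j <= d ->
  isomorphic (That n d (d - j).+1) (That n d j.+1).
Proof.
move=> dn jd; have jd1 : j.+1 <= d.+1 by [].
have [sz us ss ix [xp hub]] := That_hub n (ltn0Sn j) jd1.
set x : That n d j.+1 := inl _ in ix xp hub.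
have -> : d - j = index x (rev (spine n d j.+1)).
  have djs : d - j < size (rev (spine n d j.+1)) by rewrite size_rev sz ltnS leq_subr.
  rewrite -[LHS](index_uniq x djs) ?rev_uniq //; rewrite size_rev in djs.
  by rewrite nth_rev // sz subSS subKn // -[j in nth _ _ j]ix nth_index.
rewrite -{1}(@That_card n d j.+1 dn).
apply: hub_isomorphic.
- exact: That_acyclic.
- by rewrite size_rev.
- by rewrite rev_uniq.
- by rewrite rev_sorted; apply: sub_sorted ss => u v; rewrite adj_sym.
- by split=> [|w wT]; rewrite mem_rev //; apply: hub.
Qed.

(** In diameter 1 all pairs of vertices are adjacent, so three vertices would
    form a triangle. This excludes the case where the extremal candidate would
    carry leaves at an end of its path. *)
Lemma tree_class_diameter1 n G : tree_class n 1 G -> n <= 2.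
Proof.
case=> -[_ acG] cG dG; rewrite leqNgt -cG; apply/negP => G2.
have adjG (x y : G) : x != y -> adj x y.
  move=> xy; have := dist_le_diameter x y; rewrite dG => le1.
  have /walkP[p [sz]] := dist_walk (leq_ltn_trans le1 (ltnW G2)).
  rewrite -{}sz in le1; case: p le1 => [|z [|t p]] //= _.
    by move=> _ e; rewrite e eqxx in xy.
  by rewrite andbT => xz <-.
have szG : size (enum G) = #|G| by rewrite -cardE.
move: (enum_uniq G) (szG) G2; case: (enum G) => [|x [|y [|z c]]] /=; try by move=> _ <-.
rewrite !inE !negb_or => /and4P[/and3P[xy xz _] /andP[yz _] _ _] _ _.
have := acG [:: x; y; z] isT; rewrite /= !inE negb_or xy xz yz !adjG //.
by rewrite eq_sym.
Qed.

(** * The extremal tree *)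

Theorem theorem1p2 (n d : nat) (hn : 2 <= n) (hd : 1 <= d <= n - 1)
    (hne : exists T : sgraph, tree_class n d T)
    (i : nat) (hi : i = d./2 + 1 \/ i = uphalf d + 1) :
  [/\ isomorphic (That n d (d./2 + 1)) (That n d (uphalf d + 1)),
      tree_class n d (That n d i),
      (forall T : sgraph, tree_class n d T ->
         num_subtrees T <= num_subtrees (That n d i) /\
         (num_subtrees T = num_subtrees (That n d i) <->
          isomorphic T (That n d i)))
    & num_subtrees (That n d i) =
        2 ^ (n - d - 1) * (d./2 + 1) * (uphalf d + 1)
        + 'C(d./2 + 1, 2) + 'C(uphalf d + 1, 2) + (n - d - 1)].
Proof.
have d_gt0 : 0 < d by case/andP: hd.
have dn : d < n by lia.
have leaf : n = d.+1 \/ 1 < d.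
  have [d1|d1] := eqVneq d 1; last by right; lia.
  by case: hne => T; rewrite d1 => /tree_class_diameter1; left; lia.
have [half_gt0 sum_half] : (1 < d -> 0 < d./2) /\ d = d./2 + uphalf d by lia.
have central_range j : central d j -> j <= d /\ (n = d.+1 \/ 1 < j.+1 <= d).
  by case/orP=> /eqP->; case: leaf => [e|/[dup] d2 /half_gt0]; split; auto; lia.
have mirror j j' : central d j -> central d j' -> j' = j \/ j' = d - j.
  by do 2 case/orP=> /eqP->; lia.
have iso j j' : central d j -> central d j' ->
    isomorphic (That n d j.+1) (That n d j'.+1).
  move=> cj cj'; have [jd _] := central_range j cj.
  case: (mirror j j' cj cj') => ->; first exact: isomorphic_refl.
  by apply: isomorphic_sym; apply: That_mirror.
have [ch cu] : central d d./2 /\ central d (uphalf d) by rewrite /central !eqxx orbT.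
have [j cj ->] : exists2 j, central d j & i = j.+1.
  by case: hi => ->; rewrite addn1; [exists d./2 | exists (uphalf d)].
have [jd leafj] := central_range j cj; have jd1 : j.+1 <= d.+1 by [].
have HT : tree_class n d (That n d j.+1).
  split; [split | exact: That_card | exact: That_diameter].
    exact: That_connected.
  exact: That_acyclic.
have num : num_subtrees (That n d j.+1) = max_subtrees n d.
  have [[Hc Ha] Hn _] := HT; have [sz us ss ix hub] := That_hub n (ltn0Sn j) jd1.
  by rewrite num_subtreesE (subtrees_hub Ha Hc sz us ss hub) ?Hn ?ix.
rewrite !addn1; split=> //; first exact: iso; last first.
  by rewrite num /max_subtrees /max_through mulnA.
move=> T [[Tc Ta] Tn Td].
have [] := @geodesic T; rewrite ?Tn ?Td ?(ltn_trans d_gt0 dn) // => p [sz up sp].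
have [le eq] := subtrees_bound Ta Tc sz up sp d_gt0.
rewrite -num_subtreesE Tn in le eq; rewrite num; split=> //; split=> [/eq[x hub cx]|].
  apply: isomorphic_trans (iso (index x p) j cx cj); apply: isomorphic_sym.
  by rewrite -Tn; apply: hub_isomorphic.
by move/num_subtrees_isomorphic->.
Qed.
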